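(* Let $p,q,r\in\mathbb{Z}$ and $M=\begin{pmatrix}p&r\\0&q\end{pmatrix}\in UT_2(\mathbb{Z})$. Then $M$ is representable as a difference of two squares in $UT_2(\mathbb{Z})$ if and only if one of the following holds: (1) $p$ and $q$ are odd, and either (i) $p\equiv q\pmod 4$ and $r\equiv 0\pmod 2$, or (ii) $p\not\equiv q\pmod 4$ and $r$ is arbitrary; (2) one of $p,q$ is odd and the other is divisible by $4$, and $r$ is arbitrary; (3) $p\equiv q\equiv 0\pmod 4$, and either (i) $(p,q)\bmod 16\in\{(4,4),(12,12)\}$ and $r\equiv 0\pmod 4$, or (ii) $(p,q)\bmod 16\in\{(4,12),(8,8),(12,4)\}$ and $r\equiv 0\pmod 2$, or (iii) $(p,q)\bmod 16\notin\{(4,4),(12,12),(4,12),(8,8),(12,4)\}$ and $r$ is arbitrary.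
   Context: $UT_2(\mathbb{Z})$ denotes the ring of upper-triangular $2\times 2$ matrices $\begin{pmatrix}a&b\\0&c\end{pmatrix}$ with $a,b,c\in\mathbb{Z}$, under the usual matrix addition and multiplication. A matrix $M\in UT_2(\mathbb{Z})$ is representable as a difference of two squares in $UT_2(\mathbb{Z})$ if there exist $A,B\in UT_2(\mathbb{Z})$ with $M=A^2-B^2$. The notation $(p,q)\bmod 16$ means the pair of residues of $p$ and $q$ in $\{0,1,\dots,15\}$ modulo $16$. *)

(* Defs.v *)
From HB Require Import structures.
From mathcomp Require Import all_boot all_order all_algebra.

Set Implicit Arguments.
Unset Strict Implicit.
Unset Printing Implicit Defensive.

Import GRing.Theory.
Local Open Scope ring_scope.

(* is_trig_mx means lower triangular, hence the transpose. *)
Definition UT2 : {pred 'M[int]_2} := fun A => is_trig_mx A^T.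

Definition mk_ut2 (p r q : int) : 'M[int]_2 :=
  \matrix_(i < 2, j < 2)
    if i == 0 then (if j == 0 then p else r) else (if j == 0 then 0 else q).

Definition diff_two_squares (M : 'M[int]_2) : Prop :=
  exists A B : 'M[int]_2, [/\ A \in UT2, B \in UT2 & M = A ^+ 2 - B ^+ 2].

Definition oddz (n : int) : bool := ~~ (2 %| n)%Z.

Lemma UT2E (A : 'M[int]_2) : (A \in UT2) = (A 1 0 == 0).
Proof.
apply/is_trig_mxP/eqP => [utA | A10 i j].
  by have := utA 0 1 isT; rewrite mxE.
rewrite mxE; case: i j => [[|[|i]] //= ilt] [[|[|j]] //= jlt] _.
by rewrite -[RHS]A10; congr (A _ _); apply: val_inj.
Qed.

Lemma mk_ut2_UT2 p r q : mk_ut2 p r q \in UT2.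
Proof. by rewrite UT2E mxE. Qed.

Fact UT2_subring_closed : subring_closed UT2.
Proof.
split=> [|A B|A B]; rewrite !UT2E ?mxE //.
  by move=> /eqP-> /eqP->; rewrite subr0.
by move=> /eqP A0 /eqP B0; rewrite big_ord_recl big_ord1 A0 mul0r add0r
  (_ : lift _ _ = 1) ?B0 ?mulr0 //; apply: val_inj.
Qed.

HB.instance Definition _ :=
  GRing.isSubringClosed.Build 'M[int]_2 UT2 UT2_subring_closed.

(* Main.v *)
Require Import Defs.
From mathcomp Require Import all_boot all_order all_algebra.
From mathcomp Require Import zify ring.

(** Write the two matrices being squared as (a x; 0 c) and (b y; 0 d).  Then
    [p = a^2 - b^2], [q = c^2 - d^2] and [r = x(a + c) - y(b + d)], so the
    diagonal is two independent differences of integer squares, and once these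
    are fixed the possible corners [r] are exactly the multiples of
    [gcd (a + c) (b + d)] ([diff_two_squaresP]).  Everything is about how small
    this gcd can be made by varying the four integers.

    Obstructions.  Squares are 0 or 1 modulo 4, so [p] and [q] are each odd or
    divisible by 4.  If both are odd and congruent modulo 4, then [a], [c] have
    the same parity, and so do [b], [d]: the gcd is even.  If [p = 4m] and
    [q = 4n], then [m = s t], [n = u v] with [a, b = t + s, t - s] and
    [c, d = v + u, v - u], so that [a + c] and [b + d] are
    [(t + s) + (v + u)] and [(t - s) + (v - u)].  The residues of [m] and [n]
    modulo 4, which are those of [p] and [q] modulo 16, control [t + s] and
    [t - s] ([factors_mod4]) and force the divisibility of [r]
    ([dvd_corner_of_dvd4_diag]).

    Constructions.  Conversely, factorizations with factors as small as
    possible make [(a + c) - (b + d)] equal to 1, 2 or 4; the gcd is then read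
    off from the residue of [a + c] modulo that number
    ([diff_two_squares_bezout]), and it meets the obstructions above. *)

Import GRing.Theory.
Local Open Scope ring_scope.

Lemma diff_two_squaresP (p q r : int) :
  diff_two_squares (mk_ut2 p r q) <->
  exists a b c d x y : int,
    [/\ p = a ^+ 2 - b ^+ 2, q = c ^+ 2 - d ^+ 2
      & r = x * (a + c) - y * (b + d)].
Proof.
have lift01 : lift ord0 ord0 = 1 :> 'I_2 by exact: val_inj.
split=> [[A [B [utA utB eM]]] | [a [b [c [d [x [y [-> -> ->]]]]]]]].
  move: utA utB; rewrite !UT2E => /eqP A10 /eqP B10.
  exists (A 0 0), (B 0 0), (A 1 1), (B 1 1), (A 0 1), (B 0 1).
  have entry i j : mk_ut2 p r q i j = (A ^+ 2 - B ^+ 2) i j by rewrite eM.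
  split; [move: (entry 0 0) | move: (entry 1 1) | move: (entry 0 1)];
    rewrite !expr2 !mxE /= !big_ord_recl !big_ord0 lift01 ?A10 ?B10 => ->; ring.
exists (mk_ut2 a x c), (mk_ut2 b y d); split; try exact: mk_ut2_UT2.
apply/matrixP=> i j; rewrite !expr2 !mxE !big_ord_recl !big_ord0 lift01 !mxE.
by case: i j => [[|[|i]] //= ?] [[|[|j]] //= ?]; rewrite /=; ring.
Qed.

(** The criterion is symmetric in the two diagonal entries, although transposing
    does not preserve upper triangular matrices. *)
Lemma diff_two_squaresC (p q r : int) :
  diff_two_squares (mk_ut2 p r q) -> diff_two_squares (mk_ut2 q r p).
Proof.
move=> /diff_two_squaresP[a [b [c [d [x [y [-> -> ->]]]]]]].
by apply/diff_two_squaresP; exists c, d, a, b, x, y; split=> //; ring.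
Qed.

(** Modulo [(a + c) - (b + d)] the integer [e] equals [a + c], hence [e] lies in
    the ideal generated by [a + c] and [b + d], and so does each multiple [r]
    of [e].  When [(a + c) - (b + d)] is small, representability thus reduces to
    a single residue. *)
Lemma diff_two_squares_bezout (a b c d e r : int) :
    ((a + c) - (b + d) %| (a + c) - e)%Z -> (e %| r)%Z ->
  diff_two_squares (mk_ut2 (a ^+ 2 - b ^+ 2) r (c ^+ 2 - d ^+ 2)).
Proof.
move=> /dvdzP[j ej] /dvdzP[k ->]; apply/diff_two_squaresP.
exists a, b, c, d, ((1 - j) * k), (- j * k); split=> //.
have -> : e = (a + c) - j * (a + c - (b + d)) by rewrite -ej; ring.
by ring.
Qed.

Lemma int_parity (a : int) : exists k, a = 2 * k \/ a = 2 * k + 1.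
Proof. by exists (a %/ 2)%Z; lia. Qed.

Lemma sqr_mod4 (a : int) : (a ^+ 2 %% 4 = a %% 2)%Z.
Proof. by have [k [->|->]] := int_parity a; rewrite expr2; lia. Qed.

Lemma int_mod4 (a : int) :
  exists k, [\/ a = 4 * k, a = 4 * k + 1, a = 4 * k + 2 | a = 4 * k + 3].
Proof.
have [k [->|->]] := int_parity a; have [l [->|->]] := int_parity k; exists l.
- by constructor 1; ring.
- by constructor 3; ring.
- by constructor 2; ring.
- by constructor 4; ring.
Qed.

(** The units modulo 4 are their own inverses: an odd product forces the two
    factors to be equal (product 1) or opposite (product 3) modulo 4.  A product
    equal to 2 modulo 4 has exactly one even factor, while a nonzero residue
    other than 2 means that both are odd. *)
Lemma factors_mod4 (s t : int) :
  [/\ (s * t %% 4)%Z = 1 -> ~~ (2 %| s)%Z /\ (4 %| t - s)%Z,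
      (s * t %% 4)%Z = 3 -> ~~ (2 %| s)%Z /\ (4 %| t + s)%Z
    & (s * t %% 4)%Z != 0 -> (2 %| t + s)%Z = ((s * t %% 4)%Z != 2)].
Proof.
have [k [] ->] := int_mod4 s; have [l [] ->] := int_mod4 t;
  split; lia.
Qed.

Lemma dvdz_combination (e A B x y : int) :
  (e %| A)%Z -> (e %| B)%Z -> (e %| x * A - y * B)%Z.
Proof. by move=> eA eB; rewrite rpredB ?dvdz_mull. Qed.

(** With [p = 2k + 1] and [q = 2l + 1] split as products with a factor 1, the
    integers [a + c] and [b + d] are [k + l + 2] and [k + l]; their gcd is 1 or
    2 according to the parity of [k + l], that is, to whether [p] and [q] differ
    modulo 4. *)
Lemma diff_two_squares_odd_odd (p q r : int) : oddz p -> oddz q ->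
  (p <> q %[mod 4])%Z \/ (2 %| r)%Z -> diff_two_squares (mk_ut2 p r q).
Proof.
rewrite /oddz.
have [k [->|->]] := int_parity p; first by lia.
have [l [->|->]] := int_parity q; first by lia.
move=> _ _ cond.
have -> : 2 * k + 1 = (k + 1) ^+ 2 - k ^+ 2 by ring.
have -> : 2 * l + 1 = (l + 1) ^+ 2 - l ^+ 2 by ring.
case: cond => [neq | r2].
  by apply: (@diff_two_squares_bezout _ _ _ _ 1); lia.
have [kl|kl] := boolP (2 %| k + l)%Z.
  by apply: (@diff_two_squares_bezout _ _ _ _ 2); lia.
by apply: (@diff_two_squares_bezout _ _ _ _ 1); lia.
Qed.

(** Factors [-1, -p] of [p] and [2, q / 2] of [q]: the difference of
    [a + c] and [b + d] is the sum [-1 + 2] of the first factors, so these are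
    consecutive integers and every corner is reached. *)
Lemma diff_two_squares_odd_dvd4 (p q r : int) :
  oddz p -> (4 %| q)%Z -> diff_two_squares (mk_ut2 p r q).
Proof.
rewrite /oddz; have [k [->|-> _]] := int_parity p; first by lia.
move=> /dvdzP[m ->].
have -> : 2 * k + 1 = (- (k + 1)) ^+ 2 - (- k) ^+ 2 by ring.
have -> : m * 4 = (m + 1) ^+ 2 - (m - 1) ^+ 2 by ring.
by apply: (@diff_two_squares_bezout _ _ _ _ 1); lia.
Qed.

(** Splitting both entries with a factor 2 gives [a + c] and [b + d] equal to
    [m + n + 2] and [m + n - 2], which differ by 4. *)
Lemma diff_two_squares_dvd4 (m n e r : int) :
  (4 %| m + n + 2 - e)%Z -> (e %| r)%Z ->
  diff_two_squares (mk_ut2 (4 * m) r (4 * n)).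
Proof.
move=> e_mod er.
have sq (x : int) : 4 * x = (x + 1) ^+ 2 - (x - 1) ^+ 2 by ring.
by rewrite (sq m) (sq n); apply: diff_two_squares_bezout er; lia.
Qed.

(** When [m] and [n] are both even, a factor 2 in both entries makes the gcd
    even.  As 4 divides [m], a factor 4 of [4m] can be combined with the factor
    -2 of [4n] instead: then [a + c] and [b + d] are odd with difference 2. *)
Lemma diff_two_squares_dvd16 (m n r : int) :
  (4 %| m)%Z -> (2 %| n)%Z -> diff_two_squares (mk_ut2 (4 * m) r (4 * n)).
Proof.
move=> /dvdzP[k ->] n2.
have -> : 4 * (k * 4) = (2 * k + 2) ^+ 2 - (2 * k - 2) ^+ 2 by ring.
have -> : 4 * n = (- n - 1) ^+ 2 - (- n + 1) ^+ 2 by ring.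
by apply: (@diff_two_squares_bezout _ _ _ _ 1); lia.
Qed.

(** A difference of squares divisible by 4 has roots of equal parity, hence
    [s = (a - b) / 2] and [t = (a + b) / 2] are integers. *)
Lemma diff_squares_dvd4 (m a b : int) : 4 * m = a ^+ 2 - b ^+ 2 ->
  exists s t, [/\ a = t + s, b = t - s & m = s * t].
Proof.
move=> em; have a4 := sqr_mod4 a; have b4 := sqr_mod4 b.
have [s ea] : exists s, a = b + 2 * s by exists ((a - b) %/ 2)%Z; lia.
by exists s, (b + s); split; lia.
Qed.

(** The obstruction for a diagonal [4m, 4n].  In the second part the condition
    says that [m, n] are 1, 3 or 3, 1 or 2, 2 modulo 4: then [t + s] and [v + u]
    have the same parity.  In the first part [t] and [v] are both [s] and [u],
    or both [-s] and [-u], modulo 4, so that of [a + c] and [b + d] one is 0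
    and the other is, up to sign, twice the sum of the odd integers [s], [u]. *)
Lemma dvd_corner_of_dvd4_diag (a b c d x y m n r : int) :
    4 * m = a ^+ 2 - b ^+ 2 -> 4 * n = c ^+ 2 - d ^+ 2 ->
    r = x * (a + c) - y * (b + d) ->
  [/\ (m %% 4)%Z = 1 /\ (n %% 4)%Z = 1 \/ (m %% 4)%Z = 3 /\ (n %% 4)%Z = 3 ->
        (4 %| r)%Z
    & (m %% 4)%Z + (n %% 4)%Z = 4 -> ((m %% 4)%Z != 0) -> (2 %| r)%Z].
Proof.
move=> em en ->.
have [s [t [ea eb st]]] := diff_squares_dvd4 _ _ _ em.
have [u [v [ec ed uv]]] := diff_squares_dvd4 _ _ _ en.
have [s1 s3 s2] := factors_mod4 s t; have [u1 u3 u2] := factors_mod4 u v.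
move: s1 s3 s2 u1 u3 u2; rewrite -st -uv ea eb ec ed => {em en st uv ea eb ec ed}.
move=> s1 s3 s2 u1 u3 u2; split=> [[] [m4 n4] | mn m0].
- have [s_odd ts] := s1 m4; have [u_odd vu] := u1 n4.
  by clear - s_odd ts u_odd vu; apply: dvdz_combination; lia.
- have [s_odd ts] := s3 m4; have [u_odd vu] := u3 n4.
  by clear - s_odd ts u_odd vu; apply: dvdz_combination; lia.
have same_parity : (2 %| t + s)%Z = (2 %| v + u)%Z.
  by rewrite s2 // u2; lia.
by clear - same_parity; apply: dvdz_combination; lia.
Qed.

Theorem theorem11 (p q r : int) :
  diff_two_squares (mk_ut2 p r q) <->
  [\/ (oddz p /\ oddz q) /\
        (((p = q %[mod 4])%Z /\ (r = 0 %[mod 2])%Z)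
         \/ (p <> q %[mod 4])%Z),
      (oddz p /\ (4 %| q)%Z) \/ (oddz q /\ (4 %| p)%Z)
    | ((p = 0 %[mod 4])%Z /\ (q = 0 %[mod 4])%Z) /\
        [\/ ((p %% 16)%Z, (q %% 16)%Z) \in ([:: (4, 4); (12, 12)] : seq (int * int))
              /\ (r = 0 %[mod 4])%Z,
            ((p %% 16)%Z, (q %% 16)%Z) \in ([:: (4, 12); (8, 8); (12, 4)] : seq (int * int))
              /\ (r = 0 %[mod 2])%Z
          | ((p %% 16)%Z, (q %% 16)%Z)
              \notin ([:: (4, 4); (12, 12); (4, 12); (8, 8); (12, 4)] : seq (int * int))]].
Proof.
split=> [/diff_two_squaresP[a [b [c [d [x [y [ep eq er]]]]]]] | ].
  have := sqr_mod4 a; have := sqr_mod4 b.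
  have := sqr_mod4 c; have := sqr_mod4 d => d4 c4 b4 a4.
  have [[op oq]|mixed|[/dvdzP[m em] /dvdzP[n en]]] :
    [\/ oddz p /\ oddz q,
        oddz p /\ (4 %| q)%Z \/ oddz q /\ (4 %| p)%Z
      | (4 %| p)%Z /\ (4 %| q)%Z].
  - rewrite /oddz.
    have [p2|p2] := boolP (2 %| p)%Z; have [q2|q2] := boolP (2 %| q)%Z.
    + by constructor 3; lia.
    + by constructor 2; lia.
    + by constructor 2; lia.
    + by constructor 1.
  - constructor 1; split=> //.
    have [pq|/eqP] := eqVneq (p %% 4)%Z (q %% 4)%Z; last by right.
    left; split=> //.
    have /dvdzP[k ->] : (2 %| r)%Z; last by lia.
    by rewrite er; apply: dvdz_combination; move: op oq; rewrite /oddz; lia.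
  - by constructor 2.
  constructor 3; split; first by lia.
  have [r4 r2] := @dvd_corner_of_dvd4_diag a b c d x y m n r ltac:(lia) ltac:(lia) er.
  (* Diagonal pairs (4,4), (12,12) modulo 16 are m = n = 1 and m = n = 3 modulo 4;
     pairs (4,12), (8,8), (12,4) are those with residues of sum 4. *)
  clear - em en r4 r2.
  have p16 : (p %% 16)%Z = (m %% 4)%Z * 4 by rewrite em; lia.
  have q16 : (q %% 16)%Z = (n %% 4)%Z * 4 by rewrite en; lia.
  rewrite {}p16 {}q16 !inE !xpair_eqE {em en}.
  have [mn|mn] := boolP ((m %% 4 == n %% 4)%Z && ((m %% 4 == 1)%Z || (m %% 4 == 3)%Z)).
    by constructor 1; lia.
  have [mn'|mn'] := boolP (((m %% 4)%Z + (n %% 4)%Z == 4) && (m %% 4 != 0)%Z).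
    by constructor 2; lia.
  by constructor 3; lia.
case=> [[[op oq] cond] | [[op q4]|[oq p4]] | [[p4 q4]]].
- by apply: diff_two_squares_odd_odd => //; case: cond => [[_ r2]|]; [right; lia|left].
- exact: diff_two_squares_odd_dvd4.
- exact/diff_two_squaresC/diff_two_squares_odd_dvd4.
have [m ->] : exists m, p = 4 * m by exists (p %/ 4)%Z; lia.
have [n ->] : exists n, q = 4 * n by exists (q %/ 4)%Z; lia.
have m16 : (4 * m %% 16)%Z = (m %% 4)%Z * 4 by lia.
have n16 : (4 * n %% 16)%Z = (n %% 4)%Z * 4 by lia.
rewrite {}m16 {}n16 {p4 q4}.
rewrite !inE !xpair_eqE.
case=> [[mn r4]|[mn r2]|mn].
- by apply: (@diff_two_squares_dvd4 _ _ 4); lia.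
- by apply: (@diff_two_squares_dvd4 _ _ 2); lia.
(* An odd m + n makes m + n + 2 congruent to 1 or -1 modulo 4; otherwise both
   are even and one of them is divisible by 4, the excluded pairs
   being those with both odd or both 2 modulo 4. *)
have [odd_mn|even_mn] := boolP (~~ (2 %| m + n)%Z).
  have [|] := boolP (4 %| m + n + 1)%Z => mn4.
    by apply: (@diff_two_squares_dvd4 _ _ 1); lia.
  by apply: (@diff_two_squares_dvd4 _ _ (-1)); lia.
have [m4|m4] := boolP (4 %| m)%Z.
  by apply: diff_two_squares_dvd16; lia.
by apply/diff_two_squaresC/diff_two_squares_dvd16; lia.
Qed.
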